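(* If a coBUG contains a connected component isomorphic to a star $K_{1,\ell}$ (for some integer $\ell\ge 0$), then it does not contain a connected component isomorphic to a cycle.
   Context: All graphs are finite, simple, undirected, with nonempty vertex set (so cycles have length at least $3$). For distinct vertices $v,w$ of a connected graph $G$, let $\sigma_{vw}$ be the number of shortest paths between $v$ and $w$, and $\sigma_{vw}(x)$ the number of those containing $x$ as an internal vertex (so $\sigma_{vw}(x)=0$ if $x\in\{v,w\}$). The betweenness of a vertex $x$ is $B_G(x)=\sum_{\{v,w\}\subseteq V(G)}\frac{\sigma_{vw}(x)}{\sigma_{vw}}$, the sum being over unordered pairs of distinct vertices. A betweenness-uniform graph (BUG) is a connected graph $G$ in which all vertices have the same betweenness. A coBUG is the complement of a BUG. $K_{1,0}$ is the single-vertex graph. *)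

(* Defs.v *)
From mathcomp Require Import all_boot all_order all_algebra.
From mathcomp Require Import zify.

Set Implicit Arguments.
Unset Strict Implicit.
Unset Printing Implicit Defensive.

Record sgraph := SGraph {
  vertex :> finType;
  adj : rel vertex;
  adj_sym : symmetric adj;
  adj_irrefl : irreflexive adj;
  vertex_gt0 : 0 < #|vertex| }.

Arguments adj {s}.

Definition isomorphic (G H : sgraph) : Prop :=
  exists2 f : G -> H, bijective f & forall x y, adj (f x) (f y) = adj x y.

Definition connected_graph (G : sgraph) : Prop :=
  forall x y : G, connect adj x y.

Section Complement.
Variable G : sgraph.

Definition compl_adj : rel G := fun x y => (x != y) && ~~ adj x y.

Lemma compl_adj_sym : symmetric compl_adj.
Proof. by move=> x y; rewrite /compl_adj eq_sym adj_sym. Qed.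

Lemma compl_adj_irrefl : irreflexive compl_adj.
Proof. by move=> x; rewrite /compl_adj eqxx. Qed.

Definition compl : sgraph :=
  SGraph compl_adj_sym compl_adj_irrefl (vertex_gt0 G).
End Complement.

Section Component.
Variables (G : sgraph) (x : G).

Definition comp_adj : rel {y : G | connect adj x y} :=
  fun u v => adj (val u) (val v).

Lemma comp_adj_sym : symmetric comp_adj.
Proof. by move=> u v; apply: adj_sym. Qed.

Lemma comp_adj_irrefl : irreflexive comp_adj.
Proof. by move=> u; apply: adj_irrefl. Qed.

Lemma comp_gt0 : 0 < #|{: {y : G | connect adj x y}}|.
Proof. by apply/card_gt0P; exists (Sub x (connect0 adj x)). Qed.

Definition component : sgraph := SGraph comp_adj_sym comp_adj_irrefl comp_gt0.
End Component.

Definition has_component (G H : sgraph) : Prop :=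
  exists x : G, isomorphic (component x) H.

Section Star.
Variable l : nat.

(* K_{1,l}: [ord0] is the centre, the other l vertices are the leaves. *)
Definition star_adj : rel 'I_l.+1 := fun i j => (i == ord0) (+) (j == ord0).

Lemma star_adj_sym : symmetric star_adj.
Proof. by move=> i j; rewrite /star_adj addbC. Qed.

Lemma star_adj_irrefl : irreflexive star_adj.
Proof. by move=> i; rewrite /star_adj addbb. Qed.

Lemma star_gt0 : 0 < #|'I_l.+1|.
Proof. by rewrite card_ord. Qed.

Definition star : sgraph := SGraph star_adj_sym star_adj_irrefl star_gt0.
End Star.

Section Cycle.
Variables (n : nat) (n_gt2 : 2 < n).

Definition cycle_adj : rel 'I_n :=
  fun i j => (i.+1 %% n == j) || (j.+1 %% n == i).

Lemma cycle_adj_sym : symmetric cycle_adj.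
Proof. by move=> i j; rewrite /cycle_adj orbC. Qed.

Lemma cycle_adj_irrefl : irreflexive cycle_adj.
Proof.
move=> i; rewrite /cycle_adj orbb; apply/eqP => h; have lt_in := ltn_ord i.
have [lt_i1n|le_ni1] := ltnP i.+1 n; first by rewrite modn_small in h; lia.
by have e : i.+1 = n by [lia]; rewrite e modnn in h; lia.
Qed.

Lemma cycle_gt0 : 0 < #|'I_n|.
Proof. by rewrite card_ord; lia. Qed.

Definition cycle_graph : sgraph :=
  SGraph cycle_adj_sym cycle_adj_irrefl cycle_gt0.
End Cycle.

Section Betweenness.
Variable G : sgraph.
Implicit Types v w x : G.

(* [v :: p] is the vertex sequence of a path from v to w, of length [size p]. *)
Definition is_path v w (p : seq G) : bool :=
  [&& path adj v p, uniq (v :: p) & last v p == w].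

(* The least length of a path from v to w; a path has length less than #|G|,
   and the value is the junk #|G| if there is none. *)
Definition dist v w : nat :=
  find (fun d => [exists p : d.-tuple G, is_path v w p]) (iota 0 #|G|).

Definition sigma v w : nat :=
  #|[set p : (dist v w).-tuple G | is_path v w p]|.

Definition sigma_through v w x : nat :=
  #|[set p : (dist v w).-tuple G |
      is_path v w p && [&& x \in v :: p, x != v & x != w]]|.

(* Each unordered pair {v, w} of distinct vertices is taken once, in the order
   of the enumeration of G; reversing paths shows that the summand is symmetric
   in v and w. *)
Definition betweenness x : rat :=
  (\sum_(v : G) \sum_(w : G | (enum_rank v < enum_rank w)%N)
     (sigma_through v w x)%:R / (sigma v w)%:R)%R.
End Betweenness.

Definition BUG (G : sgraph) : Prop :=
  connected_graph G /\ forall x y : G, betweenness x = betweenness y.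

Definition coBUG (G : sgraph) : Prop :=
  exists2 H : sgraph, BUG H & isomorphic G (compl H).

(* Main.v *)
Require Import Defs.
From mathcomp Require Import all_boot all_order all_algebra.
From mathcomp Require Import zify.

(** Let H be a BUG whose complement K has a star component and a cycle component.
  As K is disconnected, H has diameter 2, and the pairs at distance 2 in H are
  the edges of K.  With n vertices, an edge uv of K has n - |N(u) :|: N(v)|
  shortest paths in H, one through each vertex x such that uv does not meet the
  closed neighbourhood N[x].  Hence the sum over the edges uv meeting N[x] of
  1 / (n - |N(u) :|: N(v)|) does not depend on x.  This sum only depends on the
  component of x: it is l / (n - l - 1) for K_{1,l} and m / (n - m) with
  m = min(k, 4) for the cycle C_k.  Equality gives (m - l) n = m, which is
  impossible since 0 < m < n. *)

Set Implicit Arguments.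
Unset Strict Implicit.
Unset Printing Implicit Defensive.

Import GRing.Theory Num.Theory.

(** * Shortest paths of length one and two *)

Section DistanceTwo.
Variable G : sgraph.
Implicit Types v w x z : G.

Definition common_nbrs v w : {set G} := [set z | adj v z && adj z w].

(** A path repeats no vertex, so its length is below [#|G|]: the search in [dist] succeeds and its
    junk value cannot occur. *)
Lemma dist_eq v w (p : seq G) :
    is_path v w p -> (forall q : seq G, is_path v w q -> size p <= size q) ->
  dist v w = size p.
Proof.
move=> pP p_min.
have lt_p : size p < #|G|.
  case/and3P: pP => _ /card_uniqP e _.
  by rewrite -[(size p).+1]/(size (v :: p)) -e max_card.
rewrite /dist; set a := fun d => _.
have ap : a (size p) by apply/existsP; exists (in_tuple p).
have has_a : has a (iota 0 #|G|).
  by apply/hasP; exists (size p); rewrite ?mem_iota.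
have lt_f : find a (iota 0 #|G|) < #|G|.
  by rewrite -{2}(size_iota 0 #|G|) -has_find.
apply/eqP; rewrite eqn_leq; apply/andP; split.
  rewrite leqNgt; apply/negP => /(before_find 0).
  by rewrite nth_iota // add0n ap.
have := nth_find 0 has_a; rewrite nth_iota // add0n => /existsP [q qP].
by rewrite -[X in _ <= X](size_tuple q); apply: p_min.
Qed.

Lemma sigma_through_adj v w x : adj v w -> sigma_through v w x = 0.
Proof.
move=> vw; have nvw : v != w by apply: contraTneq vw => ->; rewrite adj_irrefl.
have d1 : dist v w = 1.
  apply: (@dist_eq v w [:: w]) => [|[|//]].
    by rewrite /is_path /= vw inE nvw eqxx.
  by rewrite /is_path /= (negPf nvw).
rewrite /sigma_through d1; apply/eqP; rewrite cards_eq0; apply/eqP/setP=> p.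
rewrite !inE; case/tupleP: p => y p; rewrite (tuple0 p) /is_path /= !inE.
by have [->|] := eqVneq y w; rewrite ?andbF // andbC; case: (x == v); case: (x == w).
Qed.

Section NonAdjacent.
Variables v w : G.
Hypotheses (neq_vw : v != w) (nadj_vw : ~~ adj v w).

Lemma is_path2 z y : is_path v w [:: z; y] = (z \in common_nbrs v w) && (y == w).
Proof.
rewrite /is_path /= !inE; have [->|] := eqVneq y w; rewrite ?andbF ?andbT //.
case vz: (adj v z) => //=; case zw: (adj z w) => //=.
rewrite (negPf neq_vw) orbF.
by apply/andP; split; [apply: contraTneq vz|apply: contraTneq zw] => ->;
  rewrite adj_irrefl.
Qed.

Hypothesis cn_neq0 : common_nbrs v w != set0.

Lemma dist2 : dist v w = 2.
Proof.
have [z zP] := set0Pn _ cn_neq0.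
apply: (@dist_eq v w [:: z; w]) => [|[|y [|//]]].
- by rewrite is_path2 zP eqxx.
- by rewrite /is_path /= (negPf neq_vw).
by rewrite /is_path /=; case: eqP => [->|]; rewrite ?(negPf nadj_vw) ?andbF.
Qed.

Lemma sigma2 : sigma v w = #|common_nbrs v w|.
Proof.
rewrite /sigma dist2.
have inj : injective (fun z : G => [tuple z; w]) by move=> a b [].
rewrite -(card_imset _ inj); apply: eq_card => p; rewrite inE.
case/tupleP: p => z p; case/tupleP: p => y p; rewrite (tuple0 p).
rewrite [is_path _ _ _](is_path2 z y).
apply/andP/imsetP => [[zP /eqP ->]|[a aP [-> ->]]].
  by exists z => //; apply: val_inj.
by rewrite aP eqxx.
Qed.

Lemma sigma_through2 x : sigma_through v w x = (x \in common_nbrs v w).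
Proof.
rewrite /sigma_through dist2.
(* The middle vertex determines the path, so at most one shortest path passes through [x]. *)
have -> : [set p : 2.-tuple G |
     is_path v w p & [&& x \in v :: p, x != v & x != w]]
   = if x \in common_nbrs v w then [set [tuple x; w]] else set0.
  apply/setP=> p; rewrite !inE.
  case/tupleP: p => z p; case/tupleP: p => y p; rewrite (tuple0 p).
  rewrite [is_path _ _ _](is_path2 z y).
  case: ifP => xP; rewrite !inE /=.
    apply/idP/eqP => [/andP[/andP[_ /eqP ->] /and3P[]]|[-> ->]].
      move=> /or3P[/eqP->|/eqP->|/eqP->]; rewrite ?eqxx //.
    have [vx xw] := andP xP; rewrite vx xw !eqxx orbT /=.
    by apply/andP; split; [apply: contraTneq vx|apply: contraTneq xw] => ->;
      rewrite adj_irrefl.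
  apply/negP => /andP[/andP[zP /eqP ->] /and3P[]].
  move=> /or3P[/eqP->|/eqP xz|/eqP->]; rewrite ?eqxx //.
  by move: zP; rewrite -xz xP.
by case: ifP; rewrite ?cards1 ?cards0.
Qed.

End NonAdjacent.
End DistanceTwo.

(** * Weights of the edges near a vertex *)

Section Load.
Variable K : sgraph.

Definition nbrs (u v : K) : {set K} := [set z | adj u z || adj v z].

(** Membership in the closed neighbourhood of [x], whose complement consists of the neighbours of
    [x] in the complement graph. *)
Definition meets (x u : K) : bool := (u == x) || adj u x.

(* Every edge is counted twice, once in each direction. *)
Definition load (n : nat) (x : K) : rat :=
  (\sum_(p : K * K | adj p.1 p.2 && (meets x p.1 || meets x p.2))
      ((n - #|nbrs p.1 p.2|)%:R)^-1)%R.

(** Meant for stars and cycles, whose edges all have the same weight, so that only a count of edges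
    remains. *)
Lemma load_const n x m c :
    (forall p : K * K, adj p.1 p.2 -> #|nbrs p.1 p.2| = m) ->
    #|[set p : K * K | adj p.1 p.2 && (meets x p.1 || meets x p.2)]| = c ->
  load n x = (c%:R / (n - m)%:R)%R.
Proof.
move=> hm <-; rewrite /load (eq_bigr (fun=> ((n - m)%:R)^-1)%R); last first.
  by move=> p /andP[/hm ->].
by rewrite sumr_const mulr_natl cardsE.
Qed.

End Load.

(** * Betweenness expressed through the complement *)

Section Complement.
Variable H : sgraph.
Local Notation K := (compl H).
Hypothesis diam2 : forall v w : H, @adj K v w -> common_nbrs v w != set0.

Lemma adj_meets (u x : H) : adj u x = ~~ @meets K x u.
Proof.
rewrite /meets /= /compl_adj; have [->|] := eqVneq u x; first exact: adj_irrefl.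
by rewrite negbK.
Qed.

Lemma mem_common_nbrs (v w x : H) :
  (x \in common_nbrs v w) = ~~ (@meets K x v || @meets K x w).
Proof. by rewrite inE [adj x w]adj_sym !adj_meets negb_or. Qed.

(** The ends of an edge of [K] are neighbours of each other, so the open neighbourhoods in [nbrs]
    already cover the closed ones. *)
Lemma card_common_nbrs (v w : H) :
  @adj K v w -> #|common_nbrs v w| = #|H| - #|@nbrs K v w|.
Proof.
move=> vw; rewrite cardsCs; congr (_ - _); apply: eq_card => x.
rewrite inE mem_common_nbrs negbK inE /meets.
have [e|_] := eqVneq v x; first by rewrite -e [@adj K w v]adj_sym vw !orbT.
have [e|//] := eqVneq w x; first by rewrite -e vw !orbT.
Qed.

Definition pair_dep (x v w : H) : rat :=
  ((sigma_through v w x)%:R / (sigma v w)%:R)%R.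

Lemma pair_depE x v w : v != w ->
  pair_dep x v w = (if @adj K v w && ~~ (@meets K x v || @meets K x w)
    then (#|H| - #|@nbrs K v w|)%:R^-1 else 0)%R.
Proof.
move=> nvw; rewrite /pair_dep.
case vw: (@adj K v w) => /=; last first.
  rewrite sigma_through_adj ?mul0r //.
  by move: vw; rewrite /= /compl_adj nvw => /negbFE.
have nadj : ~~ adj v w by case/andP: vw.
rewrite sigma2 ?sigma_through2 ?diam2 // card_common_nbrs //.
by rewrite mem_common_nbrs; case: ifP; rewrite ?mul0r ?mul1r.
Qed.

(** The symmetry is read off the formula in [pair_depE], without reversing paths. *)
Lemma pair_depC x v w : v != w -> pair_dep x v w = pair_dep x w v.
Proof.
move=> nvw; rewrite !pair_depE //; last by rewrite eq_sym.
rewrite [@adj K w v]adj_sym [@meets K x w || _]orbC.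
suff -> : @nbrs K v w = @nbrs K w v by [].
by apply/setP=> z; rewrite !inE orbC.
Qed.

(** Edges of [K] that miss the closed neighbourhood of [x] contribute to the betweenness, the others
    to the load. The right side is free of [x], so equal betweenness forces equal load. *)
Lemma betweenness_load (x : H) :
  (betweenness x *+ 2 + load #|H| (x : K)
   = \sum_(p : K * K | adj p.1 p.2) ((#|H| - #|nbrs p.1 p.2|)%:R)^-1)%R.
Proof.
have -> : (betweenness x *+ 2 = \sum_(p : H * H | p.1 != p.2) pair_dep x p.1 p.2)%R.
  rewrite -(pair_big_dep xpredT (fun v w : H => v != w) (pair_dep x)) /=.
  (* Ordered pairs split into those following the enumeration and those against it; each half sums
     to the betweenness. *)
  transitivity (\sum_(v : H) (\sum_(w : H | (enum_rank v < enum_rank w)%N) pair_dep x v w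
     + \sum_(w : H | (enum_rank w < enum_rank v)%N) pair_dep x v w))%R; last first.
    apply: eq_bigr => v _.
    rewrite [RHS](bigID (fun w => (enum_rank v < enum_rank w)%N)) /=.
    by congr (_ + _)%R; apply: eq_bigl => w;
      rewrite -(inj_eq enum_rank_inj) -(inj_eq val_inj) /=; lia.
  rewrite big_split mulr2n /=; congr (_ + _)%R.
  rewrite (exchange_big_dep xpredT) //=; apply: eq_bigr => v _; apply: eq_bigr => w lt_wv.
  by rewrite -/(pair_dep x w v) pair_depC //; apply: contraTneq lt_wv => ->; rewrite ltnn.
rewrite (eq_bigr (fun p : H * H => if @adj K p.1 p.2 && ~~ (@meets K x p.1 || @meets K x p.2)
    then (#|H| - #|@nbrs K p.1 p.2|)%:R^-1 else 0)%R); last by move=> p /pair_depE ->.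
rewrite -big_mkcondr [RHS](bigID (fun p : H * H => @meets K x p.1 || @meets K x p.2)) addrC /=.
congr (_ + _)%R; apply: eq_bigl => p.
by case: (p.1 =P p.2) => [->|] //=; rewrite /compl_adj eqxx.
Qed.

End Complement.

(** * Transfer between a graph and its components *)

(* [g] identifies S with a union of connected components of K. *)
Definition component_map (S K : sgraph) (g : S -> K) : Prop :=
  [/\ injective g, forall i j, adj (g i) (g j) = adj i j
    & forall i y, adj (g i) y -> exists j, y = g j].

Lemma has_component_map (G K S : sgraph) :
  isomorphic G K -> has_component G S -> exists g : S -> K, component_map g.
Proof.
move=> [f [f' fK f'K] f_adj] [x [h [h' hK h'K] h_adj]].
exists (fun i => f (val (h' i))); split.
- by move=> i j /(can_inj fK) /val_inj /(can_inj h'K).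
- by move=> i j; rewrite f_adj -[LHS]/(@adj (component x) _ _) -h_adj !h'K.
move=> i y; rewrite -[y]f'K f_adj => iy.
have xy : connect adj x (f' y) := connect_trans (valP (h' i)) (connect1 iy).
by exists (h (Sub (f' y) xy)); rewrite hK.
Qed.

Section ComponentMap.
Variables (S K : sgraph) (g : S -> K).
Hypothesis gP : component_map g.

Lemma component_map_nbrs i j : nbrs (g i) (g j) = g @: nbrs i j.
Proof.
have [g_inj g_adj g_cl] := gP; apply/setP=> z; rewrite inE.
apply/orP/imsetP => [[]zP|[a]].
- by have [a za] := g_cl _ _ zP; exists a => //; move: zP; rewrite za g_adj inE => ->.
- by have [a za] := g_cl _ _ zP; exists a => //; move: zP; rewrite za g_adj inE orbC => ->.
by rewrite inE => /orP aP ->; rewrite !g_adj.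
Qed.

(** An edge meeting the closed neighbourhood of [g i] has one end in the image of [g], hence both by
    closure, so the two sums match edge by edge. *)
Lemma component_map_load n i : load n (g i) = load n i.
Proof.
have [g_inj g_adj g_cl] := gP.
have g_meets a b : meets (g a) (g b) = meets a b by rewrite /meets g_adj (inj_eq g_inj).
pose gg (p : S * S) := (g p.1, g p.2).
have gg_inj : injective gg by move=> [a b] [c d] [/g_inj -> /g_inj ->].
have meetsP u : meets (g i) u -> exists a, u = g a.
  case/orP => [/eqP ->|]; first by exists i.
  by rewrite adj_sym; apply: g_cl.
pose A : {set S * S} := [set p | adj p.1 p.2 && (meets i p.1 || meets i p.2)].
transitivity (\sum_(p in gg @: A) ((n - #|nbrs p.1 p.2|)%:R^-1 : rat))%R.
  apply: eq_bigl => -[u v]; apply/idP/imsetP => /= [/andP[uv uvP]|[[a b]]].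
    suff [[a ua] [b vb]] : (exists a, u = g a) /\ (exists b, v = g b).
      by exists (a, b); [move: uv uvP; rewrite inE ua vb g_adj !g_meets => -> ->|rewrite ua vb].
    case/orP: uvP => /meetsP [a ea].
      by split; [exists a|apply: (g_cl a); rewrite -ea].
    by split; [apply: (g_cl a); rewrite -ea adj_sym|exists a].
  by rewrite inE /= => abP [-> ->]; rewrite g_adj !g_meets.
rewrite big_imset; last exact: in2W.
apply: eq_big => [p|p _]; first by rewrite inE.
by rewrite component_map_nbrs card_imset.
Qed.

End ComponentMap.

(** * Loads in stars and cycles *)

Lemma star_load n l : load n (ord0 : star l) = (l.*2%:R / (n - l.+1)%:R)%R.
Proof.
(* Each edge joins the centre to a leaf, so its [nbrs] is the whole star; all [l] edges count, in
   both directions. *)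
apply: load_const => [[i j] /= ij|].
  rewrite -[RHS](card_ord l.+1); apply/eq_card => z; rewrite !inE /= /star_adj.
  by move: ij; rewrite /star_adj; do 3!case: (_ == ord0).
pose out (i : 'I_l) : star l * star l := (ord0, lift ord0 i).
pose inw (i : 'I_l) : star l * star l := (lift ord0 i, ord0).
have out_inj : injective out by move=> i j /(congr1 snd) /lift_inj.
have inw_inj : injective inw by move=> i j /(congr1 fst) /lift_inj.
have -> : [set p : star l * star l |
    adj p.1 p.2 && (meets (ord0 : star l) p.1 || meets (ord0 : star l) p.2)]
  = [set out i | i : 'I_l] :|: [set inw i | i : 'I_l].
  apply/setP=> -[i j]; rewrite !inE /meets /= /star_adj.
  apply/idP/orP => [|[] /imsetP[k _ [-> ->]] //].
  case: (unliftP ord0 i) => [i' ->|->]; case: (unliftP ord0 j) => [j' ->|->] //= _.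
    by right; apply: imset_f.
  by left; apply: imset_f.
rewrite cardsU !card_imset // card_ord (_ : _ :&: _ = set0) ?cards0 ?subn0 ?addnn //.
by apply/setP=> -[i j]; rewrite !inE; apply/negP => /andP[/imsetP[a _ [-> ->]] /imsetP[b _ []]].
Qed.

Section Cycle.
Variables (k : nat) (k_gt2 : 2 < k).
Local Notation C := (cycle_graph k_gt2).

Lemma cycle_adjE (i j : C) : adj i j =
  [|| j == i.+1 :> nat, (i.+1 == k) && (j == 0 :> nat),
      i == j.+1 :> nat | (j.+1 == k) && (i == 0 :> nat)].
Proof.
have modS (a : 'I_k) : a.+1 %% k = if a.+1 == k then 0 else a.+1.
  by case: eqP => [->|]; rewrite ?modnn // => ne; rewrite modn_small //; have := ltn_ord a; lia.
have := ltn_ord i; have := ltn_ord j.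
by rewrite /= /cycle_adj !modS; case: (i.+1 =P k); case: (j.+1 =P k) => /=; lia.
Qed.

Lemma card_cycle_nbr (i : C) : #|[set z : C | adj i z]| = 2.
Proof.
have lt_i := ltn_ord i.
have lt_s : (if i.+1 == k then 0 else i.+1) < k by case: eqP; lia.
have lt_p : (if i == 0 :> nat then k.-1 else i.-1) < k by case: eqP; lia.
have -> : [set z : C | adj i z] = [set Ordinal lt_s; Ordinal lt_p].
  apply/setP=> z; rewrite !inE cycle_adjE -!val_eqE /=; have := ltn_ord z.
  by case: (i.+1 =P k); case: (i =P 0 :> nat) => /=; lia.
by rewrite cards2 -val_eqE /=; case: (i.+1 =P k); case: (i =P 0 :> nat) => /=; lia.
Qed.

(** In a triangle the two neighbourhoods cover everything; in a longer cycle adjacent vertices share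
    no neighbour, which gives 2 + 2. *)
Lemma card_cycle_nbrs (i j : C) : adj i j -> #|nbrs i j| = minn k 4.
Proof.
have lt_i := ltn_ord i; have lt_j := ltn_ord j; rewrite cycle_adjE => ij.
have -> : nbrs i j = [set z | adj i z] :|: [set z | adj j z].
  by apply/setP=> z; rewrite !inE.
have [k3|k_gt3] := leqP k 3.
  transitivity #|C|; last by rewrite card_ord; lia.
  apply: eq_card => z; rewrite !inE !cycle_adjE; have := ltn_ord z; lia.
rewrite cardsU !card_cycle_nbr (_ : _ :&: _ = set0) ?cards0; first by lia.
apply/setP=> z; rewrite !inE !cycle_adjE; have := ltn_ord z; lia.
Qed.

Lemma cycle_load n :
  exists x : C, load n x = ((minn k 4).*2%:R / (n - minn k 4)%:R)%R.
Proof.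
have [k_gt0 k_gt1 lt_k1 lt_k2] : [/\ 0 < k, 1 < k, k.-1 < k & k.-2 < k] by split; lia.
pose o a : C := Ordinal (ltn_pmod a k_gt0).
have o_eq a (i : C) : a < k -> (i == o a) = (i == a :> nat).
  by move=> lt_a; rewrite -val_eqE /= modn_small.
exists (o 0); apply: load_const => [[i j]|]; first exact: card_cycle_nbrs.
(* Both directions of the edges meeting the closed neighbourhood {k-1, 0, 1} of 0. For [k = 3] the
   edge from k-1 to k-2 is the edge from 2 to 1, already listed. *)
pose s := [:: (o 0, o 1); (o 1, o 0); (o 1, o 2); (o 2, o 1);
              (o 0, o k.-1); (o k.-1, o 0)] ++
  (if k == 3 then [::] else [:: (o k.-1, o k.-2); (o k.-2, o k.-1)]).
have -> : (minn k 4).*2 = size s by rewrite /s; case: eqP; rewrite /=; lia.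
have <- : #|s| = size s.
  apply/card_uniqP; rewrite /s; case: eqP => k3.
    by rewrite /= !inE !xpair_eqE -!val_eqE /= !modn_small; lia.
  by rewrite /= !inE !xpair_eqE -!val_eqE /= !modn_small; lia.
rewrite cardsE; apply: eq_card => -[i j]; have := ltn_ord i; have := ltn_ord j.
rewrite unfold_in -[LHS]/(adj i j && (meets (o 0) i || meets (o 0) j)).
have o0 : o 0 = 0 :> nat by exact: mod0n.
rewrite /meets !cycle_adjE o0 /s mem_cat !inE !xpair_eqE !o_eq //.
case: (k =P 3) => k3; rewrite ?in_nil ?inE ?xpair_eqE ?o_eq //.
  by clear -k3; move: (nat_of_ord i) (nat_of_ord j) => a b; rewrite k3;
    case: a b => [|[|[|a]]] [|[|[|b]]].
clear -k3 k_gt2; move: (nat_of_ord i) (nat_of_ord j) => a b lt_b lt_a.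
case: (a =P 0) => [->|a0] /=; first lia.
case: (a =P 1) => [->|a1] /=; first lia.
case: (a =P 2) => [->|a2] /=; first lia.
case: (a =P k.-1) => [->|a3] /=; first lia.
case: (a =P k.-2) => [->|a4] /=; lia.
Qed.
End Cycle.

(** * Two separate components: disjointness, common neighbours, size *)

Lemma component_maps_disjoint (K : sgraph) l k (k_gt2 : 2 < k)
    (g : star l -> K) (h : cycle_graph k_gt2 -> K) :
  component_map g -> component_map h -> forall i j, g i != h j.
Proof.
move=> [g_inj g_adj g_cl] [h_inj h_adj h_cl] i j; apply/negP => /eqP e.
(* A shared vertex pulls first the centre of the star, then [ord_max], into the cycle. *)
have h0 : exists j0, g ord0 = h j0.
  have [i0|ni0] := eqVneq i ord0; first by exists j; rewrite -i0.
  by apply: (h_cl j); rewrite -e g_adj /= /star_adj (negPf ni0) eqxx.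
have [j1 e1] : exists j1, g ord_max = h j1.
  have [|ni0] := eqVneq (ord_max : star l) ord0; first by move->.
  have [j0 e0] := h0.
  by apply: (h_cl j0); rewrite -e0 g_adj /= /star_adj (negPf ni0) eqxx.
(* [ord_max] is a leaf, or the centre if [l = 0]: it has at most one neighbour, while a vertex of a
   cycle has two. *)
have : [set z | adj j1 z] \subset h @^-1: [set g ord0].
  apply/subsetP=> z; rewrite !inE => zP.
  have [a ea] : exists a, h z = g a by apply: (g_cl ord_max); rewrite e1 h_adj.
  rewrite ea; have : adj (g ord_max) (g a) by rewrite e1 -ea h_adj.
  rewrite g_adj /= /star_adj; have [->|na] := eqVneq a ord0 => //.
  by have := ltn_ord a; move: na; rewrite -!val_eqE /=; lia.
move=> /subset_leq_card; rewrite card_cycle_nbr leqNgt ltnS.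
rewrite -(card_imset _ h_inj) (leq_trans (subset_leq_card _) (eq_leq (cards1 (g ord0)))) //.
by apply/subsetP=> _ /imsetP[z + ->]; rewrite !inE.
Qed.

(** An edge of [compl H] stays on one side of the image of [g], so a vertex of [T] or of [S] is
    joined in [H] to both of its ends. *)
Lemma component_maps_diam2 (H S T : sgraph) (g : S -> compl H) (h : T -> compl H) :
    component_map g -> component_map h -> (forall i j, g i != h j) ->
  forall v w : H, @adj (compl H) v w -> common_nbrs v w != set0.
Proof.
move=> [_ _ g_cl] [_ _ h_cl] gh v w vw; apply/set0Pn.
have [/existsP [i /eqP vi]|/existsPn nv] := boolP [exists i, v == g i].
  have /card_gt0P [j _] := vertex_gt0 T.
  have nmeets a : meets (h j) (g a) = false.
    apply/norP; split; first exact: gh.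
    by apply/negP => /g_cl [b e]; have := gh b j; rewrite -e eqxx.
  have [i' wi'] : exists i', w = g i' by apply: (g_cl i); rewrite -vi.
  by exists (h j); rewrite mem_common_nbrs vi wi' !nmeets.
have /card_gt0P [i _] := vertex_gt0 S.
have nmeets (u : compl H) : (forall a, u != g a) -> meets (g i) u = false.
  move=> nu; apply/norP; split; first exact: nu.
  by apply/negP; rewrite adj_sym => /g_cl [b /eqP e]; have := nu b; rewrite e.
exists (g i); rewrite mem_common_nbrs !nmeets // => a; apply/negP => /eqP e.
have [b /eqP vb] : exists b, v = g b by apply: (g_cl a); rewrite -e adj_sym.
by have := nv b; rewrite vb.
Qed.

Lemma component_maps_card (K S T : sgraph) (g : S -> K) (h : T -> K) :
    component_map g -> component_map h -> (forall i j, g i != h j) ->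
  #|S| + #|T| <= #|K|.
Proof.
move=> [g_inj _ _] [h_inj _ _] gh.
rewrite -(card_codom g_inj) -(card_codom h_inj) -[leqRHS](cardC (mem (codom g))).
rewrite leq_add2l; apply: subset_leq_card; apply/subsetP=> _ /codomP[j ->].
by rewrite !inE; apply/negP => /codomP[i /eqP e]; have := gh i j; rewrite eq_sym e.
Qed.

(** * Comparison of the two loads *)

Theorem corollary16 (G : sgraph) (hG : coBUG G)
    (hstar : exists l : nat, has_component G (star l)) :
  ~ (exists (n : nat) (n_gt2 : 2 < n), has_component G (cycle_graph n_gt2)).
Proof.
move: hG hstar => [H [_ B_const] GK] [l hl] [k [k_gt2 hk]].
have [g gP] := has_component_map GK hl.
have [h hP] := has_component_map GK hk.
have gh := component_maps_disjoint gP hP.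
have le_card : l.+1 + k <= #|H|.
  by have := component_maps_card gP hP gh; rewrite !card_ord.
have B_load := betweenness_load (component_maps_diam2 gP hP gh).
have [x x_load] := cycle_load k_gt2 #|H|.
have : load #|H| (g ord0) = load #|H| (h x).
  by apply: (addrI (betweenness (g ord0 : H) *+ 2)%R);
    rewrite B_load (B_const (g ord0) (h x)) B_load.
rewrite (component_map_load gP) (component_map_load hP) star_load x_load => /eqP.
(* By [le_card] both truncated differences are positive, so cross-multiplication is valid. *)
rewrite eqr_div ?pnatr_eq0 -?natrM ?eqr_nat; try lia.
set m := minn k 4; have [m_gt0 le_mk] : 0 < m /\ m <= k by split; lia.
move: m m_gt0 le_mk (#|H|) le_card => m m_gt0 le_mk n le_n /eqP e.
have {}e : l * n + m = m * n by nia.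
(* If m <= l, then l n + m exceeds m n; otherwise m n - l n is at least n, which exceeds m. *)
have [le_ml|lt_lm] := leqP m l; nia.
Qed.
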